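(* Let $q\equiv 3\bmod 4$ be a prime, and let $A,B\subset\mathbb{F}_q^2$ with $|A|=|B|\ge q$. Then, for almost every $g\in SO(2)$, one has $|\Delta(A,gB)|\gg q$.
   Context: $\mathbb{F}_q$ is the finite field with $q$ elements. $SO(2)$ is the group of $2\times2$ orthogonal matrices over $\mathbb{F}_q$ with determinant $1$. $gB=\{gb:b\in B\}$. For $X,Y\subset\mathbb{F}_q^2$, $\Delta(X,Y)=\{\|x-y\|: x\in X,\ y\in Y\}\subset\mathbb{F}_q$, where $\|x\|=x_1^2+x_2^2$. ''For almost every $g\in SO(2)$ property $X(g)$ holds'' means: there is an absolute constant $c>0$, independent of $q$ and the sets under consideration, such that $X(g)$ holds for at least $c|SO(2)|$ elements $g\in SO(2)$. $X\gg Y$ means $Y\le CX$ for an absolute constant $C>0$. *)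

(* Defs.v *)
From HB Require Import structures.
From mathcomp Require Import all_boot all_order all_algebra.
From mathcomp Require Import reals.
Set Implicit Arguments.
Unset Strict Implicit.
Unset Printing Implicit Defensive.
Import GRing.Theory.
Local Open Scope ring_scope.

Definition SO2 (F : finFieldType) : {set 'M[F]_2} :=
  [set g : 'M[F]_2 | (g *m g^T == 1%:M) && (\det g == 1)].

Definition mxact (F : finFieldType) (g : 'M[F]_2) (B : {set 'cV[F]_2}) :
  {set 'cV[F]_2} := [set g *m b | b in B].

(* The quadratic form written ||x|| (no square root is taken). *)
Definition qnorm (F : finFieldType) (x : 'cV[F]_2) : F :=
  x ord0 ord0 ^+ 2 + x ord_max ord0 ^+ 2.

Definition Delta (F : finFieldType) (X Y : {set 'cV[F]_2}) : {set F} :=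
  [set qnorm (x - y) | x in X, y in Y].

(* "P g for almost every g", with the proportion c made explicit; c must be
   quantified before the field and the sets on which P depends. *)
Definition almost_every (R : realType) (F : finFieldType) (c : R)
    (P : pred 'M[F]_2) : Prop :=
  c * #|SO2 F|%:R <= #|[set g in SO2 F | P g]|%:R.

(* Main.v *)
Require Import Defs.
From HB Require Import structures.
From mathcomp Require Import all_boot all_order all_algebra.
From mathcomp Require Import reals.
From mathcomp Require Import finfield zify ring.
Set Implicit Arguments.
Unset Strict Implicit.
Unset Printing Implicit Defensive.
Import GRing.Theory.
Local Open Scope ring_scope.

(** Fix a single nonzero point a of A; the distances from a to gB already
suffice.  Say that b and b' collide under g if a is equidistant from gb and
gb'.

Identify the plane with E = F[i], where [qnorm] is the norm of E over F, and
SO(2) with the elements of norm 1, acting by multiplication.  Then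
|a - gb| = |a| + |b| - 2 <a, gb>, so that a collision of b and b' under g is
the linear equation 2 <a, g (b - b')> = |b| - |b'| in g.  The coefficients of
this equation are twice the two coordinates of the product of a with the
conjugate of b - b'.  Since q = 3 mod 4, -1 is not a square, so E is a field
and this product vanishes only when b = b'.  Otherwise the equation defines a
line, which meets the unit circle SO(2) in at most two points
([card_equidistant_le2]).

Summing over all b, b' in B, the total number of collisions over all rotations
is at most 2 |B|^2 + |SO(2)| |B|, and this is at most 3 |SO(2)| |B|^2 / q
because |B| >= q and |SO(2)| >= q ([card_SO2_ge]).  By Markov's inequality
([half_le_twice_average]), at least half of the rotations g produce at most
6 |B|^2 / q collisions, and for these the Cauchy-Schwarz inequality
([sqr_card_le_collisions]) gives at least q / 6 distinct values |a - gb|.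
Hence c = 1/2 and C = 6 work. *)

(** * Collisions and averages *)

Section Counting.
Local Open Scope nat_scope.

Definition collisions (T U : finType) (f : T -> U) (B : {set T}) : nat :=
  \sum_(b in B) \sum_(b' in B) (f b == f b').

(** Cauchy-Schwarz against the constant function 1, by summing
2 n_i n_j <= n_i^2 + n_j^2 over all pairs. *)
Lemma sqr_sum_le (I : finType) (S : {set I}) (n : I -> nat) :
  (\sum_(i in S) n i) ^ 2 <= #|S| * \sum_(i in S) n i ^ 2.
Proof.
rewrite -(leq_pmul2l (isT : 0 < 2)).
have -> : 2 * (\sum_(i in S) n i) ^ 2 =
    \sum_(i in S) \sum_(j in S) 2 * (n i * n j).
  rewrite -mulnn big_distrlr big_distrr /=.
  by apply: eq_bigr => i _; rewrite big_distrr.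
have -> : 2 * (#|S| * \sum_(i in S) n i ^ 2) =
    \sum_(i in S) \sum_(j in S) (n i ^ 2 + n j ^ 2).
  under [RHS]eq_bigr do rewrite big_split /= sum_nat_const.
  by rewrite big_split /= sum_nat_const -big_distrr /= mul2n addnn.
apply: leq_sum => i _; apply: leq_sum => j _.
exact: (nat_Cauchy (n i) (n j)).1.
Qed.

(** The sizes of the fibers of f add up to #|B|, and their squares to the number
of collisions, so Cauchy-Schwarz turns few collisions into many values. *)
Lemma sqr_card_le_collisions (T U : finType) (f : T -> U) (B : {set T}) :
  #|B| ^ 2 <= #|f @: B| * collisions f B.
Proof.
have fiber b : b \in B ->
    \sum_(u in f @: B) (u == f b) = 1.
  move=> Bb; rewrite (bigD1 (f b)) ?imset_f //= eqxx big1 // => u.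
  by case/andP=> _ /negPf->.
pose n u := \sum_(b in B) (u == f b).
have -> : #|B| = \sum_(u in f @: B) n u.
  rewrite exchange_big /= -sum1_card.
  by apply: eq_bigr => b /fiber.
suff -> : collisions f B = \sum_(u in f @: B) n u ^ 2 by apply: sqr_sum_le.
under [RHS]eq_bigr do rewrite -mulnn big_distrlr /=.
rewrite exchange_big /=; apply: eq_bigr => b Bb.
rewrite exchange_big /=; apply: eq_bigr => b' Bb'.
rewrite (bigD1 (f b)) ?imset_f //= eqxx mul1n big1 ?addn0 //.
by move=> u /andP[_ /negPf->].
Qed.

(** Markov's inequality: each of the other g contributes more than 2 M. *)
Lemma half_le_twice_average (T : finType) (G : {set T}) (f : T -> nat) M :
  \sum_(g in G) f g <= M * #|G| ->
  #|G| <= 2 * #|[set g in G | f g <= 2 * M]|.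
Proof.
set good := [set g in G | _] => avg.
pose bad := [set g in G | 2 * M < f g].
have cardG : #|G| = #|good| + #|bad|.
  rewrite -(cardsID [set g | f g <= 2 * M] G).
  congr (_ + _); apply: eq_card => g; rewrite !inE //.
  by rewrite -ltnNge andbC.
have : #|bad| * (2 * M).+1 <= M * #|G|.
  apply: leq_trans avg; rewrite -sum_nat_const.
  rewrite [leqRHS](big_setID [set g | 2 * M < f g]) /=.
  apply: leq_trans (leq_addr _ _).
  rewrite [leqRHS](eq_bigl (mem bad)); first last.
    by move=> g; rewrite !inE.
  by apply: leq_sum => g; rewrite inE => /andP[].
rewrite cardG; nia.
Qed.
End Counting.

(** * Plane rotations *)

Section Plane.
Variable F : finFieldType.
Implicit Types (x y : 'cV[F]_2) (c s : F).

(** [dot x y] and [cross x y] are the two coordinates of x times the conjugate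
of y, when (x_0, x_1) is identified with x_0 + i x_1. *)
Definition dot x y : F :=
  x ord0 ord0 * y ord0 ord0 + x ord_max ord0 * y ord_max ord0.

Definition cross x y : F :=
  x ord_max ord0 * y ord0 ord0 - x ord0 ord0 * y ord_max ord0.

Definition rot c s : 'M[F]_2 :=
  \matrix_(i, j) if i == j then c else if i == ord0 then - s else s.

Lemma ord2_cases (i : 'I_2) : i = ord0 \/ i = ord_max.
Proof. by case: i => [[|[|//]] lti]; [left | right]; apply: val_inj. Qed.

Lemma lift_ord2 : lift ord0 ord0 = ord_max :> 'I_2.
Proof. exact: val_inj. Qed.

Lemma big_ord2 (f : 'I_2 -> F) : \sum_i f i = f ord0 + f ord_max.
Proof. by rewrite !big_ord_recl big_ord0 addr0 lift_ord2. Qed.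

Lemma det_ord2 (g : 'M[F]_2) :
  \det g = g ord0 ord0 * g ord_max ord_max - g ord0 ord_max * g ord_max ord0.
Proof.
rewrite (expand_det_row _ ord0) big_ord2 /cofactor !det_mx11 !mxE /=.
rewrite lift_ord2; have -> : lift ord_max ord0 = ord0 :> 'I_2 by apply: val_inj.
by rewrite /=; ring.
Qed.

Lemma SO2P (g : 'M[F]_2) :
  reflect (exists c s, c ^+ 2 + s ^+ 2 = 1 /\ g = rot c s) (g \in SO2 F).
Proof.
rewrite inE; apply: (iffP andP) => [[/eqP/matrixP orth /eqP] | [c [s [cs ->]]]].
- rewrite det_ord2; move: (orth ord0 ord0) (orth ord0 ord_max).
  rewrite !mxE !big_ord2 !mxE /=.
  set a := g ord0 ord0; set b := g ord0 ord_max.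
  set c := g ord_max ord0; set d := g ord_max ord_max => aabb acbd det.
  (* d - a and b + c are linear combinations of the three relations. *)
  have da : d = a.
    apply/eqP; rewrite -subr_eq0; apply/eqP.
    have -> : d - a = d * (1 - (a * a + b * b)) + b * (a * c + b * d)
      + a * (a * d - b * c - 1) by ring.
    by rewrite aabb acbd det; ring.
  have bc : b = - c.
    apply/eqP; rewrite -addr_eq0; apply/eqP.
    have -> : b + c = c * (1 - (a * a + b * b)) + a * (a * c + b * d)
      - b * (a * d - b * c - 1) by ring.
    by rewrite aabb acbd det; ring.
  exists a, c; split; first by rewrite -[RHS]aabb bc; ring.
  apply/matrixP => i j; rewrite mxE.
  by case: (ord2_cases i) => ->; case: (ord2_cases j) => -> /=.
- rewrite det_ord2 !mxE /=; split; last by rewrite -cs; apply/eqP; ring.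
  apply/eqP/matrixP => i j; rewrite !mxE big_ord2 !mxE /=.
  case: (ord2_cases i) => ->; case: (ord2_cases j) => -> /=;
    rewrite ?mulr1n ?mulr0n -?cs; ring.
Qed.

Lemma rot_inj c s c' s' : rot c s = rot c' s' -> c = c' /\ s = s'.
Proof.
move=> /matrixP e; move: (e ord0 ord0) (e ord_max ord0).
by rewrite !mxE.
Qed.

Lemma qnorm_sub_rot c s x y : c ^+ 2 + s ^+ 2 = 1 ->
  qnorm (x - rot c s *m y) =
    qnorm x + qnorm y - 2 * (c * dot x y + s * cross x y).
Proof.
move=> cs; have -> : qnorm y = (c ^+ 2 + s ^+ 2) * qnorm y by rewrite cs mul1r.
by rewrite /qnorm /dot /cross !mxE !big_ord2 !mxE /=; ring.
Qed.

Lemma dot_subr x y y' : dot x (y - y') = dot x y - dot x y'.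
Proof. by rewrite /dot !mxE; ring. Qed.

Lemma cross_subr x y y' : cross x (y - y') = cross x y - cross x y'.
Proof. by rewrite /cross !mxE; ring. Qed.

(** Brahmagupta's identity: the norm of F[i] is multiplicative. *)
Lemma dot2_cross2 x y : dot x y ^+ 2 + cross x y ^+ 2 = qnorm x * qnorm y.
Proof. by rewrite /dot /cross /qnorm; ring. Qed.

Lemma card_sqrt_le2 (e : F) : (#|[set m : F | m ^+ 2 == e]| <= 2)%N.
Proof.
have [->|[m]] := set_0Vmem [set m : F | m ^+ 2 == e]; first by rewrite cards0.
rewrite inE => /eqP me.
apply: leq_trans (_ : #|[set m; - m]| <= 2)%N; last first.
  by rewrite cards2; case: (_ != _).
by apply/subset_leq_card/subsetP => n; rewrite !inE -me eqf_sqr.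
Qed.

(** * Collisions under rotations for an anisotropic norm *)

Hypothesis anisotropic : forall c s : F, c ^+ 2 + s ^+ 2 = 0 -> c = 0 /\ s = 0.

Lemma qnorm_eq0 x : qnorm x = 0 -> x = 0.
Proof.
move=> /anisotropic[x0 x1]; apply/matrixP => i j; rewrite (ord1 j) mxE.
by case: (ord2_cases i) => ->.
Qed.

Lemma two_neq0 : 2 != 0 :> F.
Proof.
apply/eqP => two0; have [] := @anisotropic 1 1; first by rewrite expr1n.
by move/eqP; rewrite oner_eq0.
Qed.

(** Stereographic projection from (-1, 0) parametrizes the rest of the unit circle
by F. *)
Lemma card_SO2_ge : (#|F| <= #|SO2 F|)%N.
Proof.
have den t : 1 + t ^+ 2 != 0 :> F.
  apply/eqP; rewrite -[X in X + _](expr1n F 2) => /anisotropic[/eqP].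
  by rewrite oner_eq0.
pose param (t : F) := rot ((1 - t ^+ 2) / (1 + t ^+ 2)) (2 * t / (1 + t ^+ 2)).
rewrite -cardsT -(@card_in_imset _ _ param); last first.
  move=> t t' _ _ /rot_inj[ec es].
  (* Adding 1 to the first coordinate isolates the denominator, which then
     cancels in the second coordinate. *)
  have inv2 u : (1 - u ^+ 2) / (1 + u ^+ 2) + 1 = 2 / (1 + u ^+ 2) :> F.
    by field; rewrite den.
  have e2 : 2 / (1 + t ^+ 2) = 2 / (1 + t' ^+ 2) by rewrite -!inv2 ec.
  have nz : 2 / (1 + t ^+ 2) != 0 by rewrite mulf_neq0 ?two_neq0 ?invr_eq0.
  by apply: (mulIf nz); rewrite [in RHS]e2 mulrCA mulrA es mulrCA mulrA.
apply/subset_leq_card/subsetP => _ /imsetP[t _ ->]; apply/SO2P.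
by do 2!eexists; split; last reflexivity; field; rewrite den.
Qed.

(** Such rotations lie on the intersection of the unit circle with the line
c u + s v = k, where (u, v) != (0, 0) by anisotropy.  The coordinate
m = u s - v c along this line determines the point, and
m^2 = u^2 + v^2 - k^2 leaves at most two values for m. *)
Lemma card_equidistant_le2 (a b b' : 'cV[F]_2) : a != 0 -> b != b' ->
  (#|[set g in SO2 F | qnorm (a - g *m b) == qnorm (a - g *m b')]| <= 2)%N.
Proof.
move=> a0 bb'.
set u := dot a (b - b'); set v := cross a (b - b').
set k := (qnorm b - qnorm b') / 2.
have D0 : u ^+ 2 + v ^+ 2 != 0.
  rewrite dot2_cross2 mulf_neq0 //; apply/eqP => /qnorm_eq0/eqP; first exact/negP.
  by rewrite subr_eq0; apply/negP.
set S := [set g in _ | _].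
have line g : g \in S -> exists c s,
    [/\ c ^+ 2 + s ^+ 2 = 1, g = rot c s & c * u + s * v = k].
  rewrite inE => /andP[/SO2P[c [s [cs ->]]]].
  rewrite !qnorm_sub_rot // => /eqP eqd; exists c, s; split=> //.
  apply: (mulIf two_neq0); rewrite divfK ?two_neq0 // /u /v dot_subr cross_subr.
  apply/eqP; rewrite -subr_eq0; apply/eqP.
  set X := qnorm a + qnorm b - _ in eqd.
  rewrite -[RHS](subrr X) {1}eqd /X; ring.
pose m (g : 'M[F]_2) := u * g ord_max ord0 - v * g ord0 ord0.
rewrite -(@card_in_imset _ _ m); last first.
  move=> _ _ /line[c [s [_ -> k1]]] /line[c' [s' [_ -> k2]]].
  rewrite /m !mxE /= => em.
  have solve (x y : F) : x * (u ^+ 2 + v ^+ 2) = (x * u + y * v) * u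
      - (u * y - v * x) * v /\
      y * (u ^+ 2 + v ^+ 2) = (x * u + y * v) * v + (u * y - v * x) * u.
    by split; ring.
  have [xc xs] := solve c s; have [xc' xs'] := solve c' s'.
  congr rot; apply: (mulIf D0).
    by rewrite xc xc' k1 k2 em.
  by rewrite xs xs' k1 k2 em.
apply: leq_trans (card_sqrt_le2 (u ^+ 2 + v ^+ 2 - k ^+ 2)).
apply/subset_leq_card/subsetP => _ /imsetP[_ /line[c [s [cs -> <-]]] ->].
(* Multiplying u^2 + v^2 by c^2 + s^2 = 1 makes this Brahmagupta's identity. *)
rewrite inE /m !mxE /= -[X in _ == X - _]mul1r -cs; apply/eqP; ring.
Qed.

(** A pair b != b' collides under at most two rotations, and the pairs b = b'
collide under all of them. *)
Lemma sum_collisions_le (a : 'cV[F]_2) (B : {set 'cV[F]_2}) : a != 0 ->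
  (\sum_(g in SO2 F) collisions (fun b => qnorm (a - g *m b)) B
    <= 2 * #|B| ^ 2 + #|SO2 F| * #|B|)%N.
Proof.
move=> a0; rewrite /collisions exchange_big /=.
have -> : (2 * #|B| ^ 2 + #|SO2 F| * #|B| =
    \sum_(b in B) (#|B| * 2 + #|SO2 F|))%N by rewrite sum_nat_const; lia.
apply: leq_sum => b Bb; rewrite exchange_big /= (bigD1 b) //= addnC.
apply: leq_add; last first.
  by rewrite -sum1_card; apply: leq_sum => g _; rewrite eqxx.
rewrite -sum_nat_const [leqRHS](bigD1 b) //=.
apply: leq_trans (leq_addl _ _); apply: leq_sum => b' /andP[_ nbb'].
rewrite eq_sym in nbb'.
apply: leq_trans (card_equidistant_le2 a0 nbb').
rewrite -sum1_card big_mkcond [leqRHS]big_mkcond; apply: leq_sum => g _.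
by rewrite inE; case: (g \in _) => //=; case: (_ == _).
Qed.

Lemma half_rotations_many_pinned_distances (a : 'cV[F]_2) (B : {set 'cV[F]_2}) :
  a != 0 -> (#|F| <= #|B|)%N ->
  (#|SO2 F| <= 2 * #|[set g in SO2 F |
     #|F| <= 6 * #|[set qnorm (a - g *m b) | b in B]|]|)%N.
Proof.
move=> a0 FB.
pose Q g := collisions (fun b => qnorm (a - g *m b)) B.
have avg : (\sum_(g in SO2 F) #|F| * Q g <= 3 * #|B| ^ 2 * #|SO2 F|)%N.
  rewrite -big_distrr /=.
  apply: leq_trans (leq_mul (leqnn _) (sum_collisions_le B a0)) _.
  have le1 := leq_mul (leqnn (2 * #|B| ^ 2)) card_SO2_ge.
  have le2 := leq_mul (leqnn (#|SO2 F| * #|B|)) FB.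
  by move: le1 le2; move: #|F| #|SO2 F| #|B|; lia.
apply: leq_trans (half_le_twice_average avg) _; rewrite leq_mul2l /=.
apply/subset_leq_card/subsetP => g; rewrite !inE => /andP[-> gQ] /=.
have := sqr_card_le_collisions (fun b => qnorm (a - g *m b)) B; rewrite -/(Q g).
move: gQ; set d := #|[set _ | _ in _]| => gQ CS.
have B0 : (0 < #|B| ^ 2)%N.
  by rewrite expn_gt0 (leq_trans _ FB) //; apply/card_gt0P; exists 0.
rewrite -(leq_pmul2r B0); apply: (leq_trans (leq_mul (leqnn _) CS)).
rewrite mulnCA; apply: leq_trans (leq_mul (leqnn d) gQ) _.
by move: (d) (#|B| ^ 2)%N => m n; lia.
Qed.
End Plane.

(** * The prime field *)

(** If t^2 = -1 and q = 4 k + 3 then t^q = -t, whereas t^q = t by Fermat. *)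
Lemma Fp_anisotropic q : prime q -> (q = 3 %[mod 4])%N ->
  forall c s : 'F_q, c ^+ 2 + s ^+ 2 = 0 -> c = 0 /\ s = 0.
Proof.
move=> pq q3 c s cs0.
have [s0 | s0] := eqVneq s 0.
  by move: cs0; rewrite s0 expr0n addr0 => /eqP; rewrite sqrf_eq0 => /eqP.
have t2 : (c / s) ^+ 2 = -1.
  by rewrite expr_div_n; move/eqP: cs0; rewrite addr_eq0 => /eqP->;
     rewrite mulNr divff ?expf_neq0.
have t0 : c / s != 0.
  by apply: contra_eq_neq t2 => ->; rewrite expr0n eq_sym oppr_eq0 oner_eq0.
have powq n : (n = 3 %[mod 4])%N -> (c / s) ^+ n = - (c / s).
  move=> n3; have -> : n = (2 * (2 * (n %/ 4)).+1).+1.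
    by rewrite {1}(divn_eq n 4) n3; lia.
  by rewrite exprS exprM t2 exprS exprM sqrrN !expr1n mulr1 mulrN1.
have /eqP := expf_card (c / s); rewrite card_Fp // powq //.
rewrite eq_sym -addr_eq0 -mulr2n -mulr_natl mulf_eq0 (negPf t0) orbF.
rewrite -(dvdn_pcharf (pchar_Fp pq)) => /dvdn_leq; lia.
Qed.

Theorem corollary1p6 (R : realType) :
  exists c C : R, 0 < c /\ 0 < C /\
  forall (q : nat), prime q -> (q = 3 %[mod 4])%N ->
  forall A B : {set 'cV['F_q]_2},
  #|A| = #|B| -> (q <= #|B|)%N ->
  almost_every c (fun g : 'M['F_q]_2 =>
    q%:R <= C * #|Delta A (mxact g B)|%:R).
Proof.
exists 2^-1, 6; split; first by rewrite Num.Theory.invr_gt0 Num.Theory.ltr0n.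
split; first by rewrite Num.Theory.ltr0n.
move=> q pq q3 A B cardAB qB.
have aniso := Fp_anisotropic pq q3.
have [a Aa a0] : exists2 a, a \in A & a != 0.
  have : (0 < #|A :\ 0%R|)%N.
    rewrite -(ltn_add2l (0%R \in A)) -cardsD1 cardAB.
    apply: leq_trans (leq_trans (prime_gt1 pq) qB).
    by case: (_ \in A).
  by case/card_gt0P => a /setD1P[a0 Aa]; exists a.
rewrite /almost_every mulrC Num.Theory.ler_pdivrMr ?Num.Theory.ltr0n //.
rewrite -natrM Num.Theory.ler_nat mulnC.
have := @half_rotations_many_pinned_distances _ aniso a B a0.
rewrite card_Fp // => /(_ qB) /leq_trans; apply; rewrite leq_mul2l /=.
apply/subset_leq_card/subsetP => g; rewrite !inE => /andP[-> /=].
rewrite -natrM Num.Theory.ler_nat => /leq_trans; apply; rewrite leq_mul2l /=.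
apply/subset_leq_card/subsetP => _ /imsetP[b Bb ->].
by apply: imset2_f => //; apply: imset_f.
Qed.
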